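(* Let $f:\mathbb{R}^n\to\mathbb{R}$ be continuously differentiable, and let $\{x_k\}$ be an infinite sequence generated by Algorithm TBB (in any of its six variants) from $x_0$. Suppose that the level set $L(x_0)=\{x\in\mathbb{R}^n: f(x)\le f(x_0)\}$ is bounded; that $f$ is twice continuously differentiable in a neighborhood of a minimum point $x^*$ of $f$, and that there exist $\varepsilon>0$ and $M>m>0$ such that $m\|y\|^2\le y^T\nabla^2f(x)y\le M\|y\|^2$ for all $y\in\mathbb{R}^n$ whenever $\|x-x^*\|<\varepsilon$; and that $\{x_k\}$ converges to $x^*$. Let $\eta_0=\inf_k\lambda_k$ (which is positive under these hypotheses) and suppose further that $$0<\alpha_{\min}\le\bar\alpha_k<\frac{M}{2\eta_0m^2\mu_1}\quad\text{for all }k.$$ Then $\{x_k\}$ is R-linearly convergent to $x^*$.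
   Context: R-linear convergence of $\{x_k\}$ to $x^*$ means $\limsup_{k\to\infty}\|x_k-x^*\|^{1/k}<1$. Algorithm TBB (three-point step size gradient method with relaxed generalized Armijo step size rule). Write $g_k=\nabla f(x_k)$. Parameters: $\mu_1,\mu_2\in(0,1)$ with $\mu_1\le\mu_2$; $\gamma_1,\gamma_2>0$; $\sigma_1\in(0,1)$; $\sigma_2\in(1,2)$; $0<\alpha_{\min}<\alpha_{\max}$; $0<\omega<1$. Start from $x_{-1}=x_0\in\mathbb{R}^n$ and $\bar\alpha_0=1$, $k=0$. At iteration $k$: (1) If $g_k=0$, stop; otherwise set $d_k=-\bar\alpha_k g_k$. (2) Choose a number $L_k$ with $0\le L_k\le \bar\alpha_k(-g_k^Td_k)/\|d_k\|^2$. Set $x_{k+1}=x_k+\lambda_kd_k$ with $\lambda_k=\omega^{p_k}$, where $p_k$ is the smallest non-negative integer for which $\lambda_k$ satisfies both (a) $f(x_k+\lambda_kd_k)\le f(x_k)+\mu_1\lambda_k\left(g_k^Td_k+\frac{1}{2\bar\alpha_k}L_k\|d_k\|^2\right)$, and (b) $\lambda_k\ge\gamma_1$, or $\lambda_k\ge\gamma_2\lambda_k^*>0$ for some $\lambda_k^*$ with $f(x_k+\lambda_k^*d_k)>f(x_k)+\mu_2\lambda_k^*\left(g_k^Td_k+\frac{1}{2\bar\alpha_k}L_k\|d_k\|^2\right)$. (3) Replace $k$ by $k+1$. With $s_{k-1}=x_k-x_{k-1}$, $s_{k-2}=x_k-x_{k-2}$, $y_{k-1}=g_k-g_{k-1}$,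 $y_{k-2}=g_k-g_{k-2}$, let $\beta_k=\frac{s_{k-1}^Ty_{k-1}}{\|y_{k-1}\|^2}$ and let $\alpha_k$ be given by one fixed choice among the following six formulas (one per variant): BB1: $\alpha_k=\alpha_k^{BB_1}:=\frac{\|s_{k-1}\|^2}{s_{k-1}^Ty_{k-1}}$; BB2: $\alpha_k=\alpha_k^{BB_2}:=\frac{s_{k-1}^Ty_{k-1}}{\|y_{k-1}\|^2}$; TBB1: $\alpha_k=\frac{\|s_{k-1}\|^2+\|s_{k-2}\|^2}{s_{k-1}^Ty_{k-1}+s_{k-2}^Ty_{k-2}}$; TBB2: $\alpha_k=\frac{s_{k-1}^Ty_{k-1}+s_{k-2}^Ty_{k-2}}{\|y_{k-1}\|^2+\|y_{k-2}\|^2}$; TBB1$'$: $\alpha_k=\lambda\alpha_k^{BB_1}+(1-\lambda)\alpha_k^{BB_2}$ with $\lambda=\left(\frac{\|s_{k-2}\|^2}{y_{k-2}^Ts_{k-2}}-\alpha_k^{BB_2}\right)/(\alpha_k^{BB_1}-\alpha_k^{BB_2})$; TBB2$'$: $\alpha_k=\lambda\alpha_k^{BB_1}+(1-\lambda)\alpha_k^{BB_2}$ with $\lambda=\left(\frac{y_{k-2}^Ts_{k-2}}{\|y_{k-2}\|^2}-\alpha_k^{BB_2}\right)/(\alpha_k^{BB_1}-\alpha_k^{BB_2})$. Put $\bar\alpha_{\min}=\max\{\alpha_{\min},\sigma_1|\beta_k|\}$ and $\bar\alpha_{\max}=\min\{\alpha_{\max},\sigma_2|\beta_k|\}$. Set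 $\bar\alpha_k=\alpha_k$ if $\bar\alpha_{\min}\le\alpha_k\le\bar\alpha_{\max}$; $\bar\alpha_k=\bar\alpha_{\min}$ if $\alpha_k<\bar\alpha_{\min}$; $\bar\alpha_k=\bar\alpha_{\max}$ if $\alpha_k>\bar\alpha_{\max}$. Return to (1). Standing assumptions: all quantities above are well defined at every iteration and the algorithm does not stop, so that $\{x_k\}$ is infinite; $\alpha_{\min}\le\beta_k\le\alpha_{\max}$ for all $k\ge1$, and $\alpha_{\min}\le 1\le\alpha_{\max}$. (Consequently $\alpha_{\min}\le\bar\alpha_k\le\alpha_{\max}$ for all $k$.) *)

(* Defs.v *)
From HB Require Import structures.
From mathcomp Require Import all_boot all_order all_algebra.
From mathcomp Require Import all_classical all_reals all_analysis.

Set Implicit Arguments.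
Unset Strict Implicit.
Unset Printing Implicit Defensive.

Import Order.TTheory GRing.Theory Num.Theory.
Import numFieldNormedType.Exports.

Local Open Scope classical_set_scope.
Local Open Scope ring_scope.

(* R^n is 'rV[R]_n. The library norm `|u| on it is the sup norm, which gives
   the same topology, bounded sets and derivatives as the Euclidean norm; the
   Euclidean norm is used wherever the value of the norm matters. *)
Definition dot (R : realType) (n : nat) (u v : 'rV[R]_n) : R :=
  \sum_(i < n) u 0 i * v 0 i.

Definition enorm (R : realType) (n : nat) (u : 'rV[R]_n) : R :=
  Num.sqrt (dot u u).

Definition gradient (R : realType) (n : nat) (f : 'rV[R]_n -> R)
    (x : 'rV[R]_n) : 'rV[R]_n :=
  \row_(i < n) 'D_(delta_mx 0 i) f x.

Definition hessian (R : realType) (n : nat) (f : 'rV[R]_n -> R)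
    (x : 'rV[R]_n) : 'M[R]_n :=
  'J (gradient f) x.

Definition continuously_differentiable (R : realType) (n : nat)
    (f : 'rV[R]_n -> R) : Prop :=
  (forall x, differentiable f x) /\ continuous (gradient f).

Definition twice_continuously_differentiable_near (R : realType) (n : nat)
    (f : 'rV[R]_n -> R) (a : 'rV[R]_n) : Prop :=
  \forall x \near a,
    [/\ differentiable f x, differentiable (gradient f) x &
        {for x, continuous (hessian f)}].

(* The term k = 0 is u `^ 0 = 1, which does not affect the limit superior. *)
Definition R_linearly_convergent (R : realType) (n : nat)
    (x : nat -> 'rV[R]_n) (a : 'rV[R]_n) : Prop :=
  (limn_esup (fun k => (enorm (x k - a) `^ (k%:R^-1))%:E) < 1%:E)%E.

Record tbb_params (R : realType) := TBBParams {
  mu1 : R; mu2 : R;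
  gamma1 : R; gamma2 : R;
  sigma1 : R; sigma2 : R;
  alpha_min : R; alpha_max : R;
  omega : R }.

Record tbb_params_ok (R : realType) (P : tbb_params R) : Prop := TBBParamsOk {
  mu1_in : 0 < mu1 P < 1;
  mu2_in : 0 < mu2 P < 1;
  mu1_le_mu2 : mu1 P <= mu2 P;
  gamma1_gt0 : 0 < gamma1 P;
  gamma2_gt0 : 0 < gamma2 P;
  sigma1_in : 0 < sigma1 P < 1;
  sigma2_in : 1 < sigma2 P < 2;
  alpha_min_gt0 : 0 < alpha_min P;
  alpha_min_lt_max : alpha_min P < alpha_max P;
  omega_in : 0 < omega P < 1 }.

Variant tbb_variant := BB1 | BB2 | TBB1 | TBB2 | TBB1' | TBB2'.

(* In the next definitions s1, y1, s2, y2 stand for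
   s_{k-1}, y_{k-1}, s_{k-2}, y_{k-2}. *)
Definition alpha_BB1 (R : realType) (n : nat) (s1 y1 : 'rV[R]_n) : R :=
  enorm s1 ^+ 2 / dot s1 y1.

Definition alpha_BB2 (R : realType) (n : nat) (s1 y1 : 'rV[R]_n) : R :=
  dot s1 y1 / enorm y1 ^+ 2.

Definition alpha (R : realType) (n : nat) (v : tbb_variant)
    (s1 y1 s2 y2 : 'rV[R]_n) : R :=
  let a1 := alpha_BB1 s1 y1 in
  let a2 := alpha_BB2 s1 y1 in
  match v with
  | BB1 => a1
  | BB2 => a2
  | TBB1 => (enorm s1 ^+ 2 + enorm s2 ^+ 2) / (dot s1 y1 + dot s2 y2)
  | TBB2 => (dot s1 y1 + dot s2 y2) / (enorm y1 ^+ 2 + enorm y2 ^+ 2)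
  | TBB1' =>
      let l := (enorm s2 ^+ 2 / dot y2 s2 - a2) / (a1 - a2) in
      l * a1 + (1 - l) * a2
  | TBB2' =>
      let l := (dot y2 s2 / enorm y2 ^+ 2 - a2) / (a1 - a2) in
      l * a1 + (1 - l) * a2
  end.

(* No denominator in the formula for alpha vanishes. *)
Definition alpha_defined (R : realType) (n : nat) (v : tbb_variant)
    (s1 y1 s2 y2 : 'rV[R]_n) : Prop :=
  match v with
  | BB1 => dot s1 y1 != 0
  | BB2 => enorm y1 ^+ 2 != 0
  | TBB1 => dot s1 y1 + dot s2 y2 != 0
  | TBB2 => enorm y1 ^+ 2 + enorm y2 ^+ 2 != 0
  | TBB1' => [/\ dot s1 y1 != 0, enorm y1 ^+ 2 != 0, dot y2 s2 != 0 &
                 alpha_BB1 s1 y1 - alpha_BB2 s1 y1 != 0]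
  | TBB2' => [/\ dot s1 y1 != 0, enorm y1 ^+ 2 != 0, enorm y2 ^+ 2 != 0 &
                 alpha_BB1 s1 y1 - alpha_BB2 s1 y1 != 0]
  end.

(* lam is the step length tried at the point x with gradient g; lams is the
   auxiliary step lambda_k^*. *)
Definition relaxed_armijo (R : realType) (n : nat) (P : tbb_params R)
    (f : 'rV[R]_n -> R) (x d g : 'rV[R]_n) (abar L lam : R) : Prop :=
  let slope := dot g d + (2 * abar)^-1 * L * enorm d ^+ 2 in
  f (x + lam *: d) <= f x + mu1 P * lam * slope /\
  (gamma1 P <= lam \/
   exists lams : R,
     [/\ gamma2 P * lams <= lam, 0 < gamma2 P * lams &
         f x + mu2 P * lams * slope < f (x + lams *: d)]).

Definition truncate_step (R : realType) (P : tbb_params R) (a beta : R) : R :=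
  let lo := Num.max (alpha_min P) (sigma1 P * `|beta|) in
  let hi := Num.min (alpha_max P) (sigma2 P * `|beta|) in
  if a < lo then lo else if hi < a then hi else a.

(* x_k - x_{k-j} and g_k - g_{k-j}. Subtraction on nat is truncated, so that for
   k = 1, j = 2 the index k - j is 0: this is the convention x_{-1} = x_0. *)
Definition sdiff (R : realType) (n : nat) (x : nat -> 'rV[R]_n)
    (k j : nat) : 'rV[R]_n :=
  x k - x (k - j)%N.

Definition ydiff (R : realType) (n : nat) (f : 'rV[R]_n -> R)
    (x : nat -> 'rV[R]_n) (k j : nat) : 'rV[R]_n :=
  gradient f (x k) - gradient f (x (k - j)%N).

Definition beta (R : realType) (n : nat) (f : 'rV[R]_n -> R)
    (x : nat -> 'rV[R]_n) (k : nat) : R :=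
  alpha_BB2 (sdiff x k 1) (ydiff f x k 1).

Definition direction (R : realType) (n : nat) (f : 'rV[R]_n -> R)
    (x : nat -> 'rV[R]_n) (abar : nat -> R) (k : nat) : 'rV[R]_n :=
  - (abar k *: gradient f (x k)).

Definition step_length (R : realType) (P : tbb_params R) (p : nat -> nat)
    (k : nat) : R :=
  omega P ^+ p k.

(* x, abar, L, p are the iterates x_k, the trial steps, the numbers L_k and the
   backtracking exponents p_k of a run that never stops. The last four fields
   say that all quantities are well defined and that beta_k, for k >= 1, and 1
   lie between alpha_min and alpha_max. *)
Record tbb_run (R : realType) (n : nat) (P : tbb_params R) (v : tbb_variant)
    (f : 'rV[R]_n -> R) (x : nat -> 'rV[R]_n) (abar L : nat -> R)
    (p : nat -> nat) : Prop := TBBRun {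
  run_nonstop : forall k, gradient f (x k) != 0;
  run_abar0 : abar 0%N = 1;
  run_L : forall k,
    0 <= L k <= abar k * (- dot (gradient f (x k)) (direction f x abar k))
                  / enorm (direction f x abar k) ^+ 2;
  run_search : forall k,
    relaxed_armijo P f (x k) (direction f x abar k) (gradient f (x k))
      (abar k) (L k) (omega P ^+ p k);
  run_search_min : forall k (q : nat), (q < p k)%N ->
    ~ relaxed_armijo P f (x k) (direction f x abar k) (gradient f (x k))
        (abar k) (L k) (omega P ^+ q);
  run_step : forall k,
    x k.+1 = x k + step_length P p k *: direction f x abar k;
  run_abar : forall k, (0 < k)%N ->
    abar k = truncate_step P
      (alpha v (sdiff x k 1) (ydiff f x k 1) (sdiff x k 2) (ydiff f x k 2))
      (beta f x k);
  run_beta_defined : forall k, (0 < k)%N -> enorm (ydiff f x k 1) ^+ 2 != 0;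
  run_alpha_defined : forall k, (0 < k)%N ->
    alpha_defined v (sdiff x k 1) (ydiff f x k 1) (sdiff x k 2) (ydiff f x k 2);
  run_beta_bounds : forall k, (0 < k)%N ->
    alpha_min P <= beta f x k <= alpha_max P;
  run_one_bounds : alpha_min P <= 1 <= alpha_max P }.

(* Main.v *)
Require Import Defs.
From mathcomp Require Import all_boot all_order all_algebra.
From mathcomp Require Import all_classical all_reals all_analysis.
From mathcomp Require Import ring lra.
Set Implicit Arguments.
Unset Strict Implicit.
Unset Printing Implicit Defensive.
Import Order.TTheory GRing.Theory Num.Theory.
Import numFieldNormedType.Exports.
Local Open Scope classical_set_scope.
Local Open Scope ring_scope.

(** Near the minimum xs the Hessian form lies between m and M, so on a convex
    ball around xs the second-order Taylor expansion sandwiches f between two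
    quadratic models ([quadratic_bounds]). Everything else uses only this
    sandwich and the vanishing of the gradient at xs.

    Positivity of eta0. Each lambda_k is a power of omega, hence positive, so it
    suffices to bound lambda_k below for large k. If lambda_k < gamma1, then the
    search rejected some lambda* <= lambda_k / gamma2. As lambda* <= 1 / gamma2
    while the gradients tend to 0, the rejected point lies in the ball, and the
    upper quadratic model shows that every lambda* with
    lambda* abar_k < 2 (1 - mu2) / M passes the Armijo test with constant mu2
    ([rejected_step_ge]). Since
    abar_k <= alpha_max, lambda* cannot be small
    ([step_length_bounded_below]).

    Linear rate. Since 0 <= L_k <= 1, the slope in the Armijo test is at most
    - abar_k |g_k|^2 / 2, and abar_k >= alpha_min, lambda_k >= eta0, so each step
    decreases f by at least a fixed multiple of |g_k|^2 ([run_decrease]).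
    Minimizing the lower quadratic model gives
    |g_k|^2 >= 2 m (f(x_k) - f(xs)) ([gradient_dominates]), so f(x_k) - f(xs)
    is eventually contracted by a fixed factor q < 1. The lower model at xs turns
    this into |x_k - xs| <= C sqrt(q)^k ([quadratic_growth]), and
    [limn_esup_root_lt1] passes to the k-th roots. *)

(** * Euclidean geometry of row vectors *)

Section Dot.
Context (R : realType) (n : nat).
Implicit Types (u v w : 'rV[R]_n).

Lemma dotDl u v w : dot (u + v) w = dot u w + dot v w.
Proof. by rewrite /dot -big_split; apply: eq_bigr => i _; rewrite mxE mulrDl. Qed.

Lemma dotZl (a : R) u w : dot (a *: u) w = a * dot u w.
Proof. by rewrite /dot mulr_sumr; apply: eq_bigr => i _; rewrite mxE mulrA. Qed.

Lemma dotC u v : dot u v = dot v u.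
Proof. by apply: eq_bigr => i _; rewrite mulrC. Qed.

Lemma dotDr u v w : dot u (v + w) = dot u v + dot u w.
Proof. by rewrite dotC dotDl !(dotC u). Qed.

Lemma dotZr (a : R) u w : dot u (a *: w) = a * dot u w.
Proof. by rewrite dotC dotZl dotC. Qed.

Lemma dot_ge0 u : 0 <= dot u u.
Proof. by apply: sumr_ge0 => i _; rewrite -expr2 sqr_ge0. Qed.

Lemma dot_gt0 u : u != 0 -> 0 < dot u u.
Proof.
move=> u0; rewrite lt0r dot_ge0 andbT; apply: contraNneq u0.
rewrite /dot => /psumr_eq0P u0; apply/eqP/rowP => i; rewrite mxE.
apply/eqP; rewrite -sqrf_eq0 expr2; apply/eqP/u0 => // j _.
by rewrite -expr2 sqr_ge0.
Qed.

Lemma enorm_sqr u : enorm u ^+ 2 = dot u u.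
Proof. by rewrite sqr_sqrtr// dot_ge0. Qed.

(** The topology is that of the sup norm, so Euclidean balls have to be shown
    to be neighborhoods. *)
Lemma enorm_near (a : 'rV[R]_n) (e : R) : 0 < e ->
  \forall z \near a, enorm (z - a) < e.
Proof.
move=> e0; have d0 : 0 < e / n.+1%:R by rewrite divr_gt0.
(* [n.+1] avoids a division by zero in dimension 0, and makes the sum of the
   squares of the [n] coordinates strictly smaller than [e ^+ 2]. *)
near=> z; have /= [_ za] : ball a (e / n.+1%:R) z by near: z; exact: nbhsx_ballx.
rewrite -(@ltr_pXn2r _ 2)// ?nnegrE ?sqrtr_ge0 ?(ltW e0)// enorm_sqr.
have -> : e ^+ 2 = \sum_(i < n.+1) (e ^+ 2 / n.+1%:R).
  by rewrite sumr_const card_ord -[RHS]mulr_natr divfK.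
rewrite big_ord_recr/= -[X in X < _]addr0 ler_ltD//; last first.
  by rewrite divr_gt0 ?exprn_gt0.
apply: ler_sum => i _; have := za 0 i; rewrite /ball/= distrC => /ltW zai.
rewrite !mxE -expr2 -real_normK ?num_real// expr2.
rewrite (le_trans (ler_pM _ _ zai zai))// -expr2 expr_div_n ler_pM2l ?exprn_gt0//.
by rewrite lef_pV2 ?posrE ?exprn_gt0// expr2 ler_peMl ?ler1n ?ler0n.
Unshelve. all: by end_near. Qed.

End Dot.

(** * Taylor estimates *)

(** Both derivatives are limits of the same difference quotients, so a single
    directional derivative of [f] transfers to the line. *)
Lemma is_derive_line (R : realType) (V W : normedModType R) (f : V -> W)
    (z h : V) (t : R) (D : W) :
  is_derive (z + t *: h) h f D -> is_derive t 1 (fun s : R => f (z + s *: h)) D.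
Proof.
have E : (fun u : R => u^-1 *: (f (z + (u *: 1 + t) *: h) - f (z + t *: h))) =
         (fun u : R => u^-1 *: (f (u *: h + (z + t *: h)) - f (z + t *: h))).
  apply/funext => u; congr (_ *: (f _ - _)).
  by rewrite [u%:A]mulr1 scalerDl addrCA.
by case=> df dD; split; [rewrite /derivable | rewrite /derive]; rewrite /= E.
Qed.

Lemma is_derive_coord (R : realType) (V : normedModType R) (k n : nat)
    (F : V -> 'M[R]_(k, n)) (x v : V) (D : 'M[R]_(k, n)) i j :
  is_derive x v F D -> is_derive x v (fun w => F w i j) (D i j).
Proof.
case=> dF <-; have dFij := (derivable_mxP _ _ _).1 dF.
by split; [exact: dFij | rewrite derive_mx// mxE].
Qed.

(** With two derivatives that need not be continuous, the estimate comes from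
    applying the mean value theorem twice, once to the function minus its
    quadratic model and once to the first derivative. *)
Lemma taylor2_lower (R : realType) (phi phi1 phi2 : R -> R) (a : R) :
  (forall t : R, 0 <= t <= 1 -> is_derive t 1 phi (phi1 t)) ->
  (forall t : R, 0 <= t <= 1 -> is_derive t 1 phi1 (phi2 t)) ->
  (forall t : R, 0 <= t <= 1 -> a <= phi2 t) ->
  phi 0 + phi1 0 + a / 2 <= phi 1.
Proof.
have MVT01 (F dF : R -> R) (t : R) : 0 <= t <= 1 ->
    (forall s : R, 0 <= s <= 1 -> is_derive s 1 F (dF s)) ->
    exists2 c, 0 <= c <= t & F t - F 0 = dF c * t.
  move=> /andP[t0 t1] dFE.
  have in01 (s : R) : s \in `[0, t] -> 0 <= s <= 1.
    by rewrite in_itv/= => /andP[-> /le_trans->].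
  have [s s0t|x x0t|c c0t ->] := @MVT_segment R F dF 0 t t0.
  - by apply/dFE/in01; apply: subset_itv_oo_cc s0t.
  - apply: derivable_within_continuous x x0t => s /in01/dFE [+ _]; exact.
  by exists c; rewrite ?subr0// -in_itv.
move=> d1 d2 a_le.
pose psi t := phi t - phi1 0 * t - a / 2 * t ^+ 2.
have dpsi (t : R) : 0 <= t <= 1 -> is_derive t 1 psi (phi1 t - phi1 0 - a * t).
  move=> /d1 dphi; apply: is_derive_eq.
  rewrite /GRing.scale/=; lra.
have [|c /andP[c0 c1]] := MVT01 psi _ 1 _ dpsi; first lra.
have [|b /andP[b0 b1] ->] := MVT01 phi1 phi2 c _ d2; first lra.
have ab : a <= phi2 b by apply: a_le; lra.
have := ler_wpM2r c0 ab.
rewrite /psi; lra.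
Qed.

Lemma taylor2_upper (R : realType) (phi phi1 phi2 : R -> R) (a : R) :
  (forall t : R, 0 <= t <= 1 -> is_derive t 1 phi (phi1 t)) ->
  (forall t : R, 0 <= t <= 1 -> is_derive t 1 phi1 (phi2 t)) ->
  (forall t : R, 0 <= t <= 1 -> phi2 t <= a) ->
  phi 1 <= phi 0 + phi1 0 + a / 2.
Proof.
move=> d1 d2 le_a.
have dN (F dF : R -> R) (t : R) :
    is_derive t 1 F (dF t) -> is_derive t 1 (fun s => - F s) (- dF t).
  by move=> ?; exact: is_deriveN.
have Nle (t : R) : 0 <= t <= 1 -> - a <= - phi2 t by move=> /le_a; rewrite lerN2.
have H := taylor2_lower (fun t t01 => dN _ _ _ (d1 t t01))
  (fun t t01 => dN _ _ _ (d2 t t01)) Nle.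
lra.
Qed.

(** The form in which all curvature information is used: m-strong convexity and
    the descent lemma for an M-Lipschitz gradient, on [B]. *)
Definition quadratic_bounds (R : realType) (n : nat) (f : 'rV[R]_n -> R)
    (m M : R) (B : set 'rV[R]_n) : Prop :=
  forall z w, B z -> B w ->
    f z + dot (gradient f z) (w - z) + m / 2 * dot (w - z) (w - z) <= f w
      <= f z + dot (gradient f z) (w - z) + M / 2 * dot (w - z) (w - z).

Lemma derive_dot_gradient (R : realType) (n : nat) (f : 'rV[R]_n -> R)
    (z h : 'rV[R]_n) :
  differentiable f z -> 'D_h f z = dot (gradient f z) h.
Proof.
move=> df; rewrite deriveE// [in LHS](row_sum_delta h) linear_sum.
by apply: eq_bigr => i _; rewrite linearZ /= mxE deriveE// mulrC.
Qed.

Lemma derive_dot_hessian (R : realType) (n : nat) (f : 'rV[R]_n -> R)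
    (z h : 'rV[R]_n) : differentiable (gradient f) z ->
  is_derive z h (fun w => dot (gradient f w) h) (dot (h *m hessian f z) h).
Proof.
move=> dg; rewrite /hessian -deriveEjacobian//.
have dgh : is_derive z h (gradient f) ('D_h (gradient f) z).
  exact/derivableP/diff_derivable.
rewrite [fun w => _](_ : _ =
    \sum_(i < n) (h 0 i *: (fun w => gradient f w 0 i))); last first.
  apply/funext => w; rewrite fct_sumE.
  by apply: eq_bigr => i _; rewrite mulrC.
have di i := is_derive_coord 0 i dgh.
apply: is_derive_eq.
by apply: eq_bigr => i _; rewrite [LHS]mulrC.
Qed.

(** Balls are convex, so the segment from [z] to [w] stays in the ball; Taylor
    estimates are applied to [f] along it, whose second derivative is the
    Hessian form in the direction [w - z]. *)
Lemma quadratic_bounds_ball (R : realType) (n : nat) (f : 'rV[R]_n -> R)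
    (m M r : R) (a : 'rV[R]_n) :
  (forall z, ball a r z -> [/\ differentiable f z,
    differentiable (gradient f) z &
    forall y, m * dot y y <= dot (y *m hessian f z) y <= M * dot y y]) ->
  quadratic_bounds f m M (ball a r).
Proof.
move=> reg z w az aw; set h := w - z.
have line (t : R) : 0 <= t <= 1 -> ball a r (z + t *: h).
  move=> t01; move: az aw; rewrite -!ball_normE/= => az aw.
  have -> : a - (z + t *: h) = (1 - t) *: (a - z) + t *: (a - w).
    by rewrite /h; apply/rowP => i; rewrite !mxE; ring.
  rewrite (le_lt_trans (ler_normD _ _))// !normrZ !ger0_norm; [|lra|lra].
  have [t1|t1] := ltP t 1; last by have -> : t = 1 by [lra]; lra.
  have : 0 < (1 - t) * (r - `|a - z|) by rewrite mulr_gt0//; lra.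
  have : 0 <= t * (r - `|a - w|) by rewrite mulr_ge0//; lra.
  lra.
have d1 (t : R) : 0 <= t <= 1 ->
    is_derive t 1 (fun s : R => f (z + s *: h)) (dot (gradient f (z + t *: h)) h).
  move=> /line/reg[df _ _]; apply: is_derive_line.
  by rewrite -derive_dot_gradient//; exact/derivableP/diff_derivable.
have d2 (t : R) : 0 <= t <= 1 ->
    is_derive t 1 (fun s : R => dot (gradient f (z + s *: h)) h)
      (dot (h *m hessian f (z + t *: h)) h).
  move=> /line/reg[_ dg _].
  exact: (is_derive_line (derive_dot_hessian h dg)).
have hb (t : R) : 0 <= t <= 1 ->
    m * dot h h <= dot (h *m hessian f (z + t *: h)) h <= M * dot h h.
  by move=> /line/reg[_ _]; exact.
have lb := taylor2_lower d1 d2 (fun t t01 => proj1 (andP (hb t t01))).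
have ub := taylor2_upper d1 d2 (fun t t01 => proj2 (andP (hb t t01))).
move: lb ub; have -> : z + 1 *: h = w by rewrite scale1r /h addrC subrK.
by rewrite scale0r addr0 => lb ub; apply/andP; split; lra.
Qed.

Lemma quadratic_bounds_near (R : realType) (n : nat) (f : 'rV[R]_n -> R)
    (m M eps : R) (a : 'rV[R]_n) :
  twice_continuously_differentiable_near f a -> 0 < eps ->
  (forall z, enorm (z - a) < eps -> forall y,
    m * enorm y ^+ 2 <= dot (y *m hessian f z) y <= M * enorm y ^+ 2) ->
  exists2 r : R, 0 < r & quadratic_bounds f m M (ball a r).
Proof.
move=> f_C2 eps_gt0 hb.
have /nbhs_ballP[r /= r0 br] : \forall z \near a,
    [/\ differentiable f z, differentiable (gradient f) z &
        {for z, continuous (hessian f)}] /\ enorm (z - a) < eps.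
  by near=> z; split; near: z; [exact: f_C2 | exact: enorm_near].
exists r => //; apply: quadratic_bounds_ball => z /br[[df dg _] za]; split=> // y.
by rewrite -enorm_sqr; exact: hb.
Unshelve. all: by end_near. Qed.

Lemma gradient_min0 (R : realType) (n : nat) (f : 'rV[R]_n -> R)
    (a : 'rV[R]_n) :
  (forall z, differentiable f z) -> (forall z, f a <= f z) -> gradient f a = 0.
Proof.
move=> df fmin; apply/rowP => i; rewrite !mxE.
have dl (t : R) : is_derive t 1 (fun s : R => f (a + s *: delta_mx 0 i))
    ('D_(delta_mx 0 i) f (a + t *: delta_mx 0 i)).
  by apply: is_derive_line; exact/derivableP/diff_derivable.
have [] := @derive1_at_min R (fun s : R => f (a + s *: delta_mx 0 i)) (-1) 1 0.
- lra.
- by move=> t _; have [] := dl t.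
- rewrite in_itv/=; lra.
- by move=> t _; rewrite scale0r addr0.
by move=> _ <-; have [_ ->] := dl 0; rewrite scale0r addr0.
Qed.

(** * Consequences of the quadratic bounds *)

Section QuadraticBounds.
Context (R : realType) (n : nat) (f : 'rV[R]_n -> R) (m M r : R) (a : 'rV[R]_n).
Hypothesis f_quad : quadratic_bounds f m M (ball a r).

(** The Polyak-Lojasiewicz inequality: the lower quadratic model at [z], whose
    minimum is [f z - dot g g / (2 * m)], bounds [f a] from below. *)
Lemma gradient_dominates (z : 'rV[R]_n) : 0 < m -> ball a r z ->
  2 * m * (f z - f a) <= dot (gradient f z) (gradient f z).
Proof.
move=> m0 az; have r0 : 0 < r.
  by move: az; rewrite -ball_normE/=; apply: le_lt_trans.
have /andP[+ _] := f_quad az (ballxx a r0).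
set g := gradient f z; set h := a - z => fa.
(* Completing the square: the minimum of the model is where [g + m *: h = 0]. *)
have := dot_ge0 (g + m *: h); rewrite dotDl !dotDr !dotZl !dotZr (dotC h g).
have m20 : 0 <= 2 * m by lra.
by have := ler_wpM2l m20 fa; nra.
Qed.

Lemma quadratic_growth (z : 'rV[R]_n) :
  gradient f a = 0 -> ball a r z -> m / 2 * dot (z - a) (z - a) <= f z - f a.
Proof.
move=> g0 az; have r0 : 0 < r.
  by move: az; rewrite -ball_normE/=; apply: le_lt_trans.
have /andP[+ _] := f_quad (ballxx a r0) az.
by rewrite g0 -[X in dot X (z - a)](scale0r (0 : 'rV[R]_n)) dotZl mul0r; lra.
Qed.

End QuadraticBounds.

(** * Real sequences *)

(** A rate [rho] strictly between [r] and 1 absorbs the constant: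
    [C * r ^+ k <= rho ^+ k] for large [k], whatever the sign of [C]. *)
Lemma limn_esup_root_lt1 (R : realType) (u : nat -> R) (C r : R) :
  (forall k, 0 <= u k) -> 0 < r < 1 -> (\forall k \near \oo, u k <= C * r ^+ k) ->
  (limn_esup (fun k => (u k `^ (k%:R^-1))%:E) < 1%:E)%E.
Proof.
move=> u0 /andP[r0 r1] uC; have [rho r_rho rho1] : exists2 rho, r < rho & rho < 1.
  by exists ((r + 1) / 2); lra.
have rho0 : 0 < rho := lt_trans r0 r_rho.
have Crho : \forall k \near \oo, C * (r / rho) ^+ k < 1.
  have : geometric C (r / rho) @ \oo --> 0.
    apply: cvg_geometric; rewrite ger0_norm ?divr_ge0 ?ltW//.
    by rewrite ltr_pdivrMr// mul1r.
  move=> /cvgrPdist_lt /(_ 1 ltr01); apply: filterS => k /=.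
  by rewrite sub0r normrN; apply: le_lt_trans; exact: ler_norm.
have root_le : \forall k \near \oo, u k `^ (k%:R^-1) <= rho.
  near=> k; have k0 : (0 < k)%N by near: k; exact: nbhs_infty_gt.
  have uk : u k <= rho ^+ k.
    have uCk : u k <= C * r ^+ k by near: k.
    have Ck : C * (r / rho) ^+ k < 1 by near: k.
    rewrite (le_trans uCk)// -[X in C * X](divfK (lt0r_neq0 (exprn_gt0 k rho0))).
    by rewrite mulrA -expr_div_n ler_piMl ?exprn_ge0 ?ltW.
  have -> : rho = (rho ^+ k) `^ (k%:R^-1).
    by rewrite -powR_mulrn ?ltW// -powRrM mulfV ?pnatr_eq0 -?lt0n// powRr1 ?ltW.
  by rewrite ge0_ler_powR ?invr_ge0 ?nnegrE ?exprn_ge0 ?u0 ?(ltW rho0).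
apply: (@le_lt_trans _ _ rho%:E); last by rewrite lte_fin.
apply: (@le_trans _ _ (ereal_sup
    [set (u k `^ (k%:R^-1))%:E | k in [set k | u k `^ (k%:R^-1) <= rho]])).
  by apply: ereal_inf_lbound; exists [set k | u k `^ (k%:R^-1) <= rho].
by apply: ge_ereal_sup => _ [k /= ? <-]; rewrite lee_fin.
Unshelve. all: by end_near. Qed.

Lemma eventual_contraction (R : realType) (e : nat -> R) (q : R) : 0 < q ->
  (\forall k \near \oo, e k.+1 <= q * e k) ->
  exists C : R, \forall k \near \oo, e k <= C * q ^+ k.
Proof.
move=> q0 [K _ eK]; exists (e K / q ^+ K); exists K => // k /=.
elim: k => [|k IHk]; first by rewrite leqn0 => /eqP ->; rewrite expr0 divr1 mulr1.
rewrite leq_eqVlt => /predU1P[<-|]; first by rewrite divfK// expf_neq0// gt_eqF.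
rewrite ltnS => Kk; rewrite (le_trans (eK _ Kk))// exprS mulrCA.
by rewrite ler_pM2l// IHk.
Qed.

Lemma pos_lower_bound (R : realType) (u : nat -> R) (c : R) :
  (forall k, 0 < u k) -> 0 < c -> (\forall k \near \oo, c <= u k) ->
  exists2 c' : R, 0 < c' & forall k, c' <= u k.
Proof.
move=> u0 + [K _]; elim: K c => [|K IHK] c c0 cu.
  by exists c => // k; exact: cu.
apply: (IHK (Num.min c (u K))) => [|k /=]; first by rewrite lt_min c0 u0.
rewrite leq_eqVlt => /predU1P[<-|Kk]; first by rewrite ge_min lexx orbT.
by rewrite ge_min cu.
Qed.

(** * One step of the line search *)

Lemma armijo_slope (R : realType) (n : nat) (g : 'rV[R]_n) (al L : R) :
  al != 0 ->
  dot g (- (al *: g)) + (2 * al)^-1 * L * enorm (- (al *: g)) ^+ 2 =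
  - (al * (1 - L / 2)) * dot g g.
Proof.
by move=> al0; rewrite enorm_sqr -(scaleNr al g) !(dotZl, dotZr); field.
Qed.

(** A failed Armijo test forces the curvature term [M / 2 * l ^+ 2 * |d|^2] of
    the upper model to exceed a fixed fraction [1 - mu] of the linear decrease
    [l * al * |g|^2]. *)
Lemma rejected_step_ge (R : realType) (n : nat) (f : 'rV[R]_n -> R)
    (m M : R) (B : set 'rV[R]_n) (z : 'rV[R]_n) (mu al L l : R) :
  let g := gradient f z in let d := - (al *: g) in
  quadratic_bounds f m M B -> B z -> B (z + l *: d) ->
  0 < M -> 0 < mu -> 0 < al -> 0 <= L -> 0 < l -> g != 0 ->
  f z + mu * l * (dot g d + (2 * al)^-1 * L * enorm d ^+ 2) < f (z + l *: d) ->
  2 * (1 - mu) / M <= l * al.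
Proof.
move=> g d f_quad Bz Bd M0 mu0 al0 L0 l0 /dot_gt0; set G := dot g g => G0.
rewrite armijo_slope ?gt_eqF// -/G.
have /andP[_] := f_quad _ _ Bz Bd.
have -> : z + l *: d - z = l *: d by rewrite addrAC subrr add0r.
rewrite -/g /d -(scaleNr al g) !(dotZl, dotZr) -/G => ub lb.
have la0 : 0 < l * al by rewrite mulr_gt0.
have key : 0 < (M / 2 * (l * al) - 1 + mu * (1 - L / 2)) * (l * al * G).
  by have := lt_le_trans lb ub; rewrite -subr_gt0; congr (0 < _); field.
move: key; rewrite pmulr_lgt0 ?mulr_gt0// => key.
rewrite ler_pdivrMr//.
have : 0 <= mu * L by rewrite mulr_ge0// ltW.
lra.
Qed.

Lemma truncate_step_bounds (R : realType) (P : tbb_params R) (al b : R) :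
  tbb_params_ok P -> alpha_min P <= b <= alpha_max P ->
  alpha_min P <= truncate_step P al b <= alpha_max P.
Proof.
move=> P_ok /andP[b1 b2]; have min0 := alpha_min_gt0 P_ok.
have /andP[s10 s11] := sigma1_in P_ok; have /andP[s21 s22] := sigma2_in P_ok.
have minmax := ltW (alpha_min_lt_max P_ok).
have b0 : 0 <= b by lra.
have : alpha_min P <= Num.max (alpha_min P) (sigma1 P * b) <= alpha_max P.
  by rewrite le_max lexx ge_max minmax /=; nra.
have : alpha_min P <= Num.min (alpha_max P) (sigma2 P * b) <= alpha_max P.
  by rewrite ge_min lexx le_min minmax /= andbT; nra.
rewrite /truncate_step ger0_norm//.
move: (Num.max _ _) (Num.min _ _) => lo hi /andP[? ?] /andP[? ?].
by case: ltP => ?; [|case: ltP => ?]; apply/andP; split; lra.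
Qed.

(** * Runs of the algorithm *)

Section Run.
Context (R : realType) (n : nat) (P : tbb_params R) (v : tbb_variant)
  (f : 'rV[R]_n -> R) (x : nat -> 'rV[R]_n) (abar L : nat -> R) (p : nat -> nat).
Hypotheses (P_ok : tbb_params_ok P) (x_run : tbb_run P v f x abar L p).

Lemma run_abar_bounds k : alpha_min P <= abar k <= alpha_max P.
Proof.
case: k => [|k]; first by rewrite (run_abar0 x_run); exact: run_one_bounds x_run.
rewrite (run_abar x_run)//; apply: truncate_step_bounds => //.
exact: run_beta_bounds x_run _ _.
Qed.

Lemma run_abar_gt0 k : 0 < abar k.
Proof.
by have /andP[+ _] := run_abar_bounds k; apply: lt_le_trans; exact: alpha_min_gt0.
Qed.

(** For a multiple of the antigradient the upper bound imposed on [L k] is 1. *)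
Lemma run_L01 k : 0 <= L k <= 1.
Proof.
have := run_L x_run k; have a0 := run_abar_gt0 k.
have g0 := dot_gt0 (run_nonstop x_run k).
rewrite /direction enorm_sqr -scaleNr !(dotZl, dotZr).
congr (_ <= _ <= _); field; lra.
Qed.

Lemma step_length_gt0 k : 0 < step_length P p k.
Proof. by rewrite exprn_gt0//; case/andP: (omega_in P_ok). Qed.

Lemma step_length_le1 k : step_length P p k <= 1.
Proof. by have /andP[? ?] := omega_in P_ok; rewrite exprn_ile1 ?ltW. Qed.

Lemma run_decrease k : f (x k.+1) <= f (x k) -
  mu1 P * step_length P p k * (alpha_min P / 2) *
  dot (gradient f (x k)) (gradient f (x k)).
Proof.
rewrite (run_step x_run); have [+ _] := run_search x_run k => /le_trans; apply.
have a0 := run_abar_gt0 k.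
rewrite /direction armijo_slope ?gt_eqF// lerD2l mulNr mulrN lerN2 [leRHS]mulrA.
rewrite ler_wpM2r ?dot_ge0// ler_pM2l; last first.
  by rewrite mulr_gt0 ?step_length_gt0//; case/andP: (mu1_in P_ok).
have /andP[La Lb] := run_L01 k; have /andP[aa _] := run_abar_bounds k.
nra.
Qed.

(** A step shorter than [gamma1] is justified by a rejected step that is at most
    [1 / gamma2] long; near [xs] the rejected point lies where the upper
    quadratic model holds, so the rejected step cannot be short. *)
Lemma step_length_bounded_below (m M r : R) (xs : 'rV[R]_n) :
  0 < r -> 0 < M -> quadratic_bounds f m M (ball xs r) ->
  continuous (gradient f) -> gradient f xs = 0 -> x @ \oo --> xs ->
  exists2 c : R, 0 < c & forall k, c <= step_length P p k.
Proof.
move=> r0 M0 f_quad g_cont g_xs x_cvg.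
have g20 := gamma2_gt0 P_ok; have g10 := gamma1_gt0 P_ok.
have amax0 : 0 < alpha_max P :=
  lt_trans (alpha_min_gt0 P_ok) (alpha_min_lt_max P_ok).
have /andP[mu20 mu21] := mu2_in P_ok.
have g_cvg : gradient f (x k) @[k --> \oo] --> (0 : 'rV[R]_n).
  by rewrite -g_xs; apply: continuous_cvg => //; exact: g_cont.
pose c := gamma2 P * (2 * (1 - mu2 P) / M / alpha_max P).
have c0 : 0 < c by rewrite !(divr_gt0, mulr_gt0, subr_gt0)//.
(* A gradient shorter than [del] keeps every rejected displacement
   [l *: direction f x abar k], with [l <= 1 / gamma2], within [r / 2]. *)
pose del := r / 2 * (gamma2 P / alpha_max P).
have del0 : 0 < del by rewrite !(divr_gt0, mulr_gt0).
apply: (@pos_lower_bound _ _ (Num.min (gamma1 P) c)).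
- exact: step_length_gt0.
- by rewrite lt_min g10.
near=> k; rewrite ge_min.
have [_ [->//|[l [l_le l_gt0 fail]]]] := run_search x_run k.
apply/orP; right.
have l0 : 0 < l by rewrite pmulr_rgt0 in l_gt0.
have l1 : gamma2 P * l <= 1 := le_trans l_le (step_length_le1 k).
have a0 := run_abar_gt0 k; have /andP[_ a1] := run_abar_bounds k.
have /andP[L0 _] := run_L01 k.
have xk : `|xs - x k| < r / 2.
  by near: k; move/cvgrPdist_lt: x_cvg; apply; rewrite divr_gt0.
have gk : `|gradient f (x k)| < del.
  near: k; move/cvgrPdist_lt: g_cvg => /(_ _ del0); apply: filterS => j.
  by rewrite sub0r normrN.
have ldk : `|l *: direction f x abar k| <= r / 2.
  rewrite /direction normrZ normrN normrZ !gtr0_norm// mulrA.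
  have la : l * abar k <= alpha_max P / gamma2 P.
    by rewrite ler_pdivlMr//; have := ler_wpM2r (ltW a0) l1; nra.
  rewrite (le_trans (ler_pM _ (normr_ge0 _) la (ltW gk)))//.
    by rewrite mulr_ge0// ltW.
  by rewrite /del le_eqVlt; apply/orP; left; apply/eqP; field; rewrite !gt_eqF.
have B1 : ball xs r (x k).
  by rewrite -ball_normE/= (lt_trans xk)// gtr_pMr// invf_lt1// ltr1n.
have B2 : ball xs r (x k + l *: direction f x abar k).
  rewrite -ball_normE/= opprD addrA (le_lt_trans (ler_normB _ _))//.
  by rewrite [ltRHS]splitr ltr_leD.
have := rejected_step_ge f_quad B1 B2 M0 mu20 a0 L0 l0 (run_nonstop x_run k) fail.
move=> key; apply: le_trans l_le; rewrite /c ler_pM2l// ler_pdivrMr//.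
by rewrite (le_trans key)// ler_pM2l.
Unshelve. all: by end_near. Qed.

End Run.

Unset Implicit Arguments.

Theorem theorem3 (R : realType) (n : nat) (f : 'rV[R]_n -> R)
    (P : tbb_params R) (v : tbb_variant)
    (x : nat -> 'rV[R]_n) (abar L : nat -> R) (p : nat -> nat)
    (xs : 'rV[R]_n) (eps m M : R)
    (f_C1 : continuously_differentiable f)
    (P_ok : tbb_params_ok P)
    (x_run : tbb_run P v f x abar L p)
    (level_bounded : bounded_set [set z | f z <= f (x 0%N)])
    (f_C2 : twice_continuously_differentiable_near f xs)
    (xs_min : forall z : 'rV[R]_n, f xs <= f z)
    (eps_gt0 : 0 < eps) (m_gt0 : 0 < m) (m_lt_M : m < M)
    (hess_bounds : forall z : 'rV[R]_n, enorm (z - xs) < eps -> forall y : 'rV[R]_n,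
        m * enorm y ^+ 2 <= dot (y *m hessian f z) y <= M * enorm y ^+ 2)
    (x_cvg : x @ \oo --> xs) :
  let eta0 : R := inf (range (step_length P p)) in
  0 < eta0 /\
  ((forall k, [/\ 0 < alpha_min P, alpha_min P <= abar k &
                  abar k < M / (2 * eta0 * m ^+ 2 * mu1 P)]) ->
   R_linearly_convergent x xs).
Proof.
move=> eta0; have [f_diff g_cont] := f_C1.
have g_xs := gradient_min0 f_diff xs_min.
have [r r0 f_quad] := quadratic_bounds_near f_C2 eps_gt0 hess_bounds.
have M0 := lt_trans m_gt0 m_lt_M.
have [c c0 c_le] :=
  step_length_bounded_below P_ok x_run r0 M0 f_quad g_cont g_xs x_cvg.
have eta_gt0 : 0 < eta0.
  apply: (lt_le_trans c0); apply: lb_le_inf => [|_ [k _ <-]//].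
  by exists (step_length P p 0), 0%N.
split=> // _; have eta_le k : eta0 <= step_length P p k.
  by apply: ge_inf; [exists c => _ [j _ <-] | exists k].
have near_ball : \forall k \near \oo, ball xs r (x k).
  by move/cvg_ballP: x_cvg; apply.
have /andP[mu10 _] := mu1_in P_ok; have amin0 := alpha_min_gt0 P_ok.
pose kappa := mu1 P * eta0 * (alpha_min P / 2).
have kappa0 : 0 < kappa by rewrite !(divr_gt0, mulr_gt0).
(* The maximum with 1 / 2 keeps the rate positive. *)
pose q := Num.max (1 - kappa * (2 * m)) (1 / 2).
have q0 : 0 < q by rewrite lt_max orbC divr_gt0.
have q1 : q < 1 by rewrite gt_max; have := mulr_gt0 kappa0 m_gt0; lra.
have [C eC] : exists C, \forall k \near \oo, f (x k) - f xs <= C * q ^+ k.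
  apply: eventual_contraction => //; near=> k.
  have xk : ball xs r (x k) by near: k.
  have pl := gradient_dominates f_quad m_gt0 xk.
  have e0 : 0 <= f (x k) - f xs by rewrite subr_ge0.
  have : (1 - kappa * (2 * m)) * (f (x k) - f xs) <= q * (f (x k) - f xs).
    by rewrite ler_wpM2r// le_max lexx.
  apply: le_trans; have dec := run_decrease P_ok x_run k.
  have G0 := dot_ge0 (gradient f (x k)).
  set G := dot _ _ in pl dec G0.
  have : kappa * G <= mu1 P * step_length P p k * (alpha_min P / 2) * G.
    by rewrite ler_wpM2r// ler_pM2r ?divr_gt0// ler_pM2l.
  have := ler_wpM2l (ltW kappa0) pl.
  lra.
apply: (@limn_esup_root_lt1 _ _ (Num.sqrt (2 / m * C)) (Num.sqrt q)) => [k||].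
- exact: sqrtr_ge0.
- by rewrite sqrtr_gt0 q0 -[ltRHS]sqrtr1 ltr_sqrt.
near=> k.
have xk : ball xs r (x k) by near: k.
have growth := quadratic_growth f_quad g_xs xk.
have eCk : f (x k) - f xs <= C * q ^+ k by near: k.
have sqX : Num.sqrt q ^+ k = Num.sqrt (q ^+ k).
  by rewrite -[q in RHS](sqr_sqrtr (ltW q0)) exprAC sqrtr_sqr ger0_norm//
    exprn_ge0// sqrtr_ge0.
rewrite sqX mulrC -sqrtrM ?exprn_ge0 ?(ltW q0)//.
apply: ler_wsqrtr; have := le_trans growth eCk.
by rewrite -ler_pdivlMl ?divr_gt0// invf_div mulrA [leRHS]mulrC.
Unshelve. all: by end_near. Qed.
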